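(* Let the data set $P=\{(\vec x_{ij},\vec z_{ij}):i=0,\dots,n,\ j=0,\dots,m\}\subset\mathbb R^4$ and the recurrent iterated function system $\{\mathbb R^4;M;\vec W_{ij},\ i=1,\dots,n,\ j=1,\dots,m\}$ be as described in the context, with $\overline S<1$. Suppose that there is a continuous function $\vec g:E\to\mathbb R^2$ with $\vec g(\vec x_{ij})=\vec z_{ij}$ for all $i=0,\dots,n$, $j=0,\dots,m$, such that for all $(i,j)\in\{1,\dots,n\}\times\{1,\dots,m\}$, with $k=\gamma(i,j)$, $$\vec F_{ij}(x_\alpha,y,\vec g(x_\alpha,y))=\vec g(\vec L_{ij}(x_\alpha,y))\qquad\text{for } \alpha\in\{s_x(k),e_x(k)\},\ y\in\tilde I_{y,k},$$ $$\vec F_{ij}(x,y_\beta,\vec g(x,y_\beta))=\vec g(\vec L_{ij}(x,y_\beta))\qquad\text{for } \beta\in\{s_y(k),e_y(k)\},\ x\in\tilde I_{x,k}.$$ Let $B$ be the attractor of this recurrent iterated function system. Then there is a continuous function $\vec f:E\to\mathbb R^2$ that interpolates $P$, i.e. $\vec f(\vec x_{ij})=\vec z_{ij}$ for all $i=0,\dots,n$, $j=0,\dots,m$, and whose graph $\{(\vec x,\vec f(\vec x)):\vec x\in E\}$ is equal to $B$.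
   Context: Data: $P=\{(x_i,y_j,z_{ij},t_{ij})=(\vec x_{ij},\vec z_{ij})\in\mathbb R^4: i=0,\dots,n,\ j=0,\dots,m\}$ with $x_0<x_1<\dots<x_n$, $y_0<y_1<\dots<y_m$, $\vec x_{ij}=(x_i,y_j)$, $\vec z_{ij}=(z_{ij},t_{ij})$ (the $z_{ij}$ are given data values, the $t_{ij}$ are arbitrary real parameters). Put $N=nm$, $E=[x_0,x_n]\times[y_0,y_m]$, $I_{x_i}=[x_{i-1},x_i]$, $I_{y_j}=[y_{j-1},y_j]$ and $E_{ij}=I_{x_i}\times I_{y_j}$ for $1\le i\le n$, $1\le j\le m$ (the ''regions''). Domains: $l$ is an integer with $2\le l\le N$. For $k=1,\dots,l$, $\tilde E_k=\tilde I_{x,k}\times\tilde I_{y,k}\subset E$ is a rectangle (a ''domain'') with $\tilde I_{x,k}=[x_{s_x(k)},x_{e_x(k)}]$, $\tilde I_{y,k}=[y_{s_y(k)},y_{e_y(k)}]$, where $s_x(k),e_x(k)\in\{0,\dots,n\}$, $s_y(k),e_y(k)\in\{0,\dots,m\}$, $e_x(k)-s_x(k)\ge2$ and $e_y(k)-s_y(k)\ge2$. For each $(i,j)\in\{1,\dots,n\}\times\{1,\dots,m\}$ an index $k=\gamma(i,j)\in\{1,\dots,l\}$ is chosen; below $k$ always means $\gamma(i,j)$. Maps $\vec L_{ij}$: $L_{x_i,k}:\tilde I_{x,k}\to I_{x_i}$ and $L_{y_j,k}:\tilde I_{y,k}\to I_{y_j}$ are contraction homeomorphisms (homeomorphisms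 that are Lipschitz with constant less than 1) mapping the set of endpoints onto the set of endpoints: $L_{x_i,k}(\{x_{s_x(k)},x_{e_x(k)}\})=\{x_{i-1},x_i\}$, $L_{y_j,k}(\{y_{s_y(k)},y_{e_y(k)}\})=\{y_{j-1},y_j\}$. For $\vec x=(x,y)\in\tilde E_k$, $\vec L_{ij}(\vec x)=(L_{x_i,k}(x),L_{y_j,k}(y))\in E_{ij}$. Maps $\vec F_{ij}$: $\vec F_{ij}:\tilde E_k\times\mathbb R^2\to\mathbb R^2$ is defined, for $\vec z=(z,t)$, by $$\vec F_{ij}(\vec x,\vec z)=\begin{pmatrix} s_{ij}(\vec L_{ij}(\vec x))\,z+s_{ij}'(\vec L_{ij}(\vec x))\,t+q_{ij}(\vec x)\\ \tilde s_{ij}(\vec L_{ij}(\vec x))\,z+\tilde s_{ij}'(\vec L_{ij}(\vec x))\,t+\tilde q_{ij}(\vec x)\end{pmatrix},$$ where $s_{ij},s_{ij}',\tilde s_{ij},\tilde s_{ij}':E_{ij}\to\mathbb R$ are Lipschitz functions whose absolute values are less than 1 (here $'$ is only a label, not a derivative), and $q_{ij},\tilde q_{ij}:\tilde E_k\to\mathbb R$ are Lipschitz functions such that: whenever $\alpha\in\{s_x(k),e_x(k)\}$, $\beta\in\{s_y(k),e_y(k)\}$, $a\in\{i-1,i\}$, $b\in\{j-1,j\}$, $L_{x_i,k}(x_\alpha)=x_a$ and $L_{y_j,k}(y_\beta)=y_b$, one has $\vec F_{ij}(\vec x_{\alpha\beta},\vec z_{\alpha\beta})=\vec z_{ab}$.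 One writes $\vec F_{ij}(x,y,\vec z)$ for $\vec F_{ij}((x,y),\vec z)$. Transformations: $\vec W_{ij}(\vec x,\vec z)=(\vec L_{ij}(\vec x),\vec F_{ij}(\vec x,\vec z))$ for $\vec x\in\tilde E_k$, $\vec z\in\mathbb R^2$, with values in $E_{ij}\times\mathbb R^2$. Constant $\overline S$: for a function $f$, $\overline f=\max|f|$ over the domain of $f$, and $\overline S=\max\{\overline{s}_{ij}+\overline{\tilde s}_{ij},\ \overline{s'}_{ij}+\overline{\tilde s'}_{ij}: i=1,\dots,n,\ j=1,\dots,m\}$. Matrix: let $\tau:\{1,\dots,n\}\times\{1,\dots,m\}\to\{1,\dots,N\}$ be the bijection $\tau(i,j)=i+(j-1)n$. $M=(p_{st})_{N\times N}$ with $p_{st}=1/a_s$ if $E_{\tau^{-1}(s)}\subseteq\tilde E_{\gamma(\tau^{-1}(t))}$ and $p_{st}=0$ otherwise, where $a_s$ is the number of domains $\tilde E_k$ containing the region $E_{\tau^{-1}(s)}$. Thus $p_{st}>0$ exactly when $E_{\tau^{-1}(s)}\subseteq\tilde E_{\gamma(\tau^{-1}(t))}$. Attractor of the recurrent iterated function system $\{\mathbb R^4;M;\vec W_{ij}\}$: the set $B=\bigcup_{t=1}^N B_t$, where $(B_1,\dots,B_N)$ is the unique $N$-tuple of nonempty compact sets $B_t\subset E_{\tau^{-1}(t)}\times\mathbb R^2$ satisfying $B_t=\bigcup_{s:\,p_{st}>0}\vec W_{\tau^{-1}(t)}(B_s)$ for $t=1,\dots,N$. *)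

(* Defs.v *)
From HB Require Import structures.
From mathcomp Require Import all_boot all_order all_algebra.
From mathcomp Require Import all_classical all_reals all_analysis.

Set Implicit Arguments.
Unset Strict Implicit.
Unset Printing Implicit Defensive.

Import Order.TTheory GRing.Theory Num.Theory.
Import numFieldNormedType.Exports.

Local Open Scope classical_set_scope.
Local Open Scope ring_scope.

(** R^2 is [R * R] and R^4 is [(R * R) * (R * R)], with the product topology
    and norm.  Grid points are indexed by ['I_n.+1] and ['I_m.+1]; the cell
    indices 1..n and 1..m are shifted to ['I_n] and ['I_m], so that the cell
    [i : 'I_n] is the interval between the grid points [lo i] and [hi i].
    The domain indices 1..l are likewise shifted to ['I_l]. *)

Definition lo n (i : 'I_n) : 'I_n.+1 := widen_ord (leqnSn n) i.
Definition hi n (i : 'I_n) : 'I_n.+1 := lift ord0 i.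

(** With the shifted indices, [i + (j - 1) n] becomes [i + j n]. *)

Fact tau_subproof n m (ij : 'I_n * 'I_m) : (ij.1 + ij.2 * n < n * m)%N.
Proof.
case: ij => i j /=; rewrite (@leq_trans (j.+1 * n)%N) //.
  by rewrite mulSn ltn_add2r.
by rewrite mulnC leq_pmul2l ?ltn_ord // (leq_ltn_trans _ (ltn_ord i)).
Qed.

Fact tau_inv1_subproof n m (s : 'I_(n * m)) : (s %% n < n)%N.
Proof. by case: s => s /=; case: n => [|n] //; rewrite ltn_mod. Qed.

Fact tau_inv2_subproof n m (s : 'I_(n * m)) : (s %/ n < m)%N.
Proof.
by case: s => s /= sP; case: n sP => [|n] // sP; rewrite ltn_divLR // mulnC.
Qed.

Definition tau n m (ij : 'I_n * 'I_m) : 'I_(n * m) := Ordinal (tau_subproof ij).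

Definition tau_inv n m (s : 'I_(n * m)) : 'I_n * 'I_m :=
  (Ordinal (tau_inv1_subproof s), Ordinal (tau_inv2_subproof s)).

Lemma tauK n m : cancel (@tau n m) (@tau_inv n m).
Proof.
move=> [i j]; have n_gt0 : (0 < n)%N by apply: leq_ltn_trans (ltn_ord i).
congr pair; apply: val_inj => /=.
  by rewrite addnC modnMDl modn_small.
by rewrite addnC divnMDl // divn_small // addn0.
Qed.

Lemma tau_invK n m : cancel (@tau_inv n m) (@tau n m).
Proof. by move=> s; apply: val_inj; rewrite /= addnC -divn_eq. Qed.

(** Functions given on a subset of R or R^2 are represented by total
    functions; every condition below only concerns their restriction to the
    intended domain. *)

Definition homeomorphism_on (T U : topologicalType) (A : set T) (B : set U)
    (f : T -> U) : Prop :=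
  [/\ set_bij A B f, {within A, continuous f} &
      exists2 h : U -> T, {within B, continuous h} &
                          forall x, A x -> h (f x) = x].

Definition contraction_homeomorphism (R : realType) (A B : set R) (f : R -> R) :
    Prop :=
  homeomorphism_on A B f /\ exists2 c : R, c < 1 & c.-lipschitz_A f.

(** [xg], [yg], [zg], [tg] are the x_i, y_j, z_ij, t_ij;
    [s1 i j], [s2 i j], [s3 i j], [s4 i j] are s_ij, s'_ij, s~_ij, s~'_ij, and
    [q1 i j], [q2 i j] are q_ij, q~_ij.  [Lx i k] and [Ly j k] are only
    meaningful when [k = gam i j]. *)
Record rifs (R : realType) (n m l : nat) := Rifs {
  xg : 'I_n.+1 -> R;
  yg : 'I_m.+1 -> R;
  zg : 'I_n.+1 -> 'I_m.+1 -> R;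
  tg : 'I_n.+1 -> 'I_m.+1 -> R;
  sx : 'I_l -> 'I_n.+1;
  ex : 'I_l -> 'I_n.+1;
  sy : 'I_l -> 'I_m.+1;
  ey : 'I_l -> 'I_m.+1;
  gam : 'I_n -> 'I_m -> 'I_l;
  Lx : 'I_n -> 'I_l -> R -> R;
  Ly : 'I_m -> 'I_l -> R -> R;
  s1 : 'I_n -> 'I_m -> R * R -> R;
  s2 : 'I_n -> 'I_m -> R * R -> R;
  s3 : 'I_n -> 'I_m -> R * R -> R;
  s4 : 'I_n -> 'I_m -> R * R -> R;
  q1 : 'I_n -> 'I_m -> R * R -> R;
  q2 : 'I_n -> 'I_m -> R * R -> R
}.

Section RifsDefs.
Context {R : realType} {n m l : nat} (D : rifs R n m l).

Definition xvec (i : 'I_n.+1) (j : 'I_m.+1) : R * R := (xg D i, yg D j).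
Definition zvec (i : 'I_n.+1) (j : 'I_m.+1) : R * R := (zg D i j, tg D i j).

Definition rectE : set (R * R) :=
  `[xg D ord0, xg D ord_max] `*` `[yg D ord0, yg D ord_max].

Definition Ix (i : 'I_n) : set R := `[xg D (lo i), xg D (hi i)].
Definition Iy (j : 'I_m) : set R := `[yg D (lo j), yg D (hi j)].
Definition region (i : 'I_n) (j : 'I_m) : set (R * R) := Ix i `*` Iy j.

Definition dom_x (k : 'I_l) : set R := `[xg D (sx D k), xg D (ex D k)].
Definition dom_y (k : 'I_l) : set R := `[yg D (sy D k), yg D (ey D k)].
Definition tdomain (k : 'I_l) : set (R * R) := dom_x k `*` dom_y k.

Definition Lmap (i : 'I_n) (j : 'I_m) (p : R * R) : R * R :=
  (Lx D i (gam D i j) p.1, Ly D j (gam D i j) p.2).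

Definition Fmap (i : 'I_n) (j : 'I_m) (p v : R * R) : R * R :=
  (s1 D i j (Lmap i j p) * v.1 + s2 D i j (Lmap i j p) * v.2 + q1 D i j p,
   s3 D i j (Lmap i j p) * v.1 + s4 D i j (Lmap i j p) * v.2 + q2 D i j p).

Definition Wmap (i : 'I_n) (j : 'I_m) (w : (R * R) * (R * R)) :
    (R * R) * (R * R) :=
  (Lmap i j w.1, Fmap i j w.1 w.2).

Definition scaling_factor (i : 'I_n) (j : 'I_m) (s : R * R -> R) : Prop :=
  [lipschitz s p | p in region i j] /\
  forall p, region i j p -> `|s p| < 1.

Record rifs_axioms : Prop := RifsAxioms {
  x_incr : forall i i' : 'I_n.+1, (i < i')%N -> xg D i < xg D i';
  y_incr : forall j j' : 'I_m.+1, (j < j')%N -> yg D j < yg D j';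
  l_bounds : (2 <= l <= n * m)%N;
  dom_x_size : forall k, (sx D k + 2 <= ex D k)%N;
  dom_y_size : forall k, (sy D k + 2 <= ey D k)%N;
  Lx_contr : forall i j, let k := gam D i j in
    contraction_homeomorphism (dom_x k) (Ix i) (Lx D i k);
  Ly_contr : forall i j, let k := gam D i j in
    contraction_homeomorphism (dom_y k) (Iy j) (Ly D j k);
  Lx_ends : forall i j, let k := gam D i j in
    Lx D i k @` [set xg D (sx D k); xg D (ex D k)] = [set xg D (lo i); xg D (hi i)];
  Ly_ends : forall i j, let k := gam D i j in
    Ly D j k @` [set yg D (sy D k); yg D (ey D k)] = [set yg D (lo j); yg D (hi j)];
  s1_scal : forall i j, scaling_factor i j (s1 D i j);
  s2_scal : forall i j, scaling_factor i j (s2 D i j);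
  s3_scal : forall i j, scaling_factor i j (s3 D i j);
  s4_scal : forall i j, scaling_factor i j (s4 D i j);
  q1_lip : forall i j, [lipschitz q1 D i j p | p in tdomain (gam D i j)];
  q2_lip : forall i j, [lipschitz q2 D i j p | p in tdomain (gam D i j)];
  F_nodes : forall i j, let k := gam D i j in
    forall (al a : 'I_n.+1) (be b : 'I_m.+1),
      al \in [:: sx D k; ex D k] -> be \in [:: sy D k; ey D k] ->
      a \in [:: lo i; hi i] -> b \in [:: lo j; hi j] ->
      Lx D i k (xg D al) = xg D a -> Ly D j k (yg D be) = yg D b ->
      Fmap i j (xvec al be) (zvec al be) = zvec a b
}.

(** The supremum is a maximum when [s] is continuous on the region, which is
    the only case of interest. *)
Definition max_abs (i : 'I_n) (j : 'I_m) (s : R * R -> R) : R :=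
  sup [set `|s p| | p in region i j].

(** All the terms are nonnegative, so the default value [0] is harmless. *)
Definition Sbar : R :=
  \big[Num.max/0]_(i < n) \big[Num.max/0]_(j < m)
    Num.max (max_abs i j (s1 D i j) + max_abs i j (s3 D i j))
            (max_abs i j (s2 D i j) + max_abs i j (s4 D i j)).

Definition region_of (s : 'I_(n * m)) : set (R * R) :=
  region (tau_inv s).1 (tau_inv s).2.
Definition domain_of (s : 'I_(n * m)) : set (R * R) :=
  tdomain (gam D (tau_inv s).1 (tau_inv s).2).
Definition W_of (s : 'I_(n * m)) := Wmap (tau_inv s).1 (tau_inv s).2.

Definition num_domains (s : 'I_(n * m)) : nat :=
  #|[set k : 'I_l | `[< region_of s `<=` tdomain k >]]%SET|.

Definition Mmat : 'M[R]_(n * m) :=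
  \matrix_(s, r) if `[< region_of s `<=` domain_of r >]
                 then (num_domains s)%:R^-1 else 0.

Definition invariant_family (B : 'I_(n * m) -> set ((R * R) * (R * R))) : Prop :=
  forall r,
    [/\ B r !=set0, compact (B r), B r `<=` region_of r `*` setT &
        B r = \bigcup_(s in [set s | 0 < Mmat s r]) (W_of r @` B s)].

(** Definite description: the union of the unique invariant family.  Should
    there be no unique such family, this would be the empty set, which is
    never the graph of a function on the nonempty rectangle [rectE]. *)
Definition attractor : set ((R * R) * (R * R)) :=
  \bigcup_r xget (fun=> set0) (unique invariant_family) r.

End RifsDefs.

Definition graph_on (T U : Type) (A : set T) (f : T -> U) : set (T * U) :=
  [set (p, f p) | p in A].

(* Main.v *)
(** The function [f] is the fixed point of the Read-Bajraktarevic operator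
    [(T h)(L_ij q) = F_ij (q, h q)], obtained as the uniform limit of [T^k g].
    Two regions only meet on grid lines, and the hypothesis on [g] says that
    [T] preserves the property of agreeing with [g] on the grid lines; hence
    [T h] is well defined and continuous for such an [h].  In the l1 norm of
    R^2, the map [F_ij (q, -)] is Lipschitz with constant [Sbar], so that the
    iterates converge geometrically.

    The graphs of [f] over the regions form an invariant family.  Conversely,
    if [B] is an invariant family, going [k] steps back along the maps [W_ij]
    shows that the points [(p, z)] of [B_r] satisfy [|z - f p| <= K Sbar^k],
    hence lie on the graph, and that the projection of [B_r] comes within
    [K c^k] of each point of the region [r], hence is the whole region because
    it is closed. *)

Require Import Defs.
From mathcomp Require Import all_boot all_order all_algebra.
From mathcomp Require Import all_classical all_reals all_analysis.
Import Order.TTheory GRing.Theory Num.Theory.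
Import numFieldNormedType.Exports.
Local Open Scope classical_set_scope.
Local Open Scope ring_scope.
From mathcomp Require Import ring lra.

(** * Continuity on subsets and geometric convergence *)

Lemma within_continuous_comp {T U V : topologicalType} (A : set T) (B : set U)
    (f : T -> U) (h : U -> V) :
  {within A, continuous f} -> {within B, continuous h} -> f @` A `<=` B ->
  {within A, continuous (h \o f)}.
Proof.
move=> /subspace_continuousP fc /subspace_continuousP hc fAB.
apply/subspace_continuousP => x Ax W /= hW.
have Bfx : B (f x) by apply: fAB; exists x.
have /(fc x Ax) := hc _ Bfx _ hW; rewrite /nbhs /=.
apply: filterS2 (withinT A _) => y Ay; apply => //.
by apply: fAB; exists y.
Qed.

Lemma within_continuous_pair {T U V : topologicalType} (A : set T)
    (f : T -> U) (h : T -> V) :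
  {within A, continuous f} -> {within A, continuous h} ->
  {within A, continuous (fun x => (f x, h x))}.
Proof. by move=> fc hc x; apply: cvg_pair; [exact: fc|exact: hc]. Qed.

(** Pasting along finitely many closed sets. The induction carries closedness along, since gluing
    two pieces needs both to be closed. *)
Lemma within_continuous_bigcup {T U : topologicalType} {I : finType}
    (A : I -> set T) (f : T -> U) :
  (forall i, closed (A i)) -> (forall i, {within A i, continuous f}) ->
  {within \bigcup_i A i, continuous f}.
Proof.
move=> Acl Ac.
suff: closed (\big[setU/set0]_(i : I) A i) /\
    {within \big[setU/set0]_(i : I) A i, continuous f}.
  case=> _; apply: continuous_subspaceW => x [i _ Aix].
  by rewrite (bigD1 i) //=; left.
apply: (big_ind (fun B => closed B /\ {within B, continuous f})) => //.
- by split; [exact: closed0|exact: continuous_subspace0].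
- move=> B C [Bcl Bc] [Ccl Cc]; split; first exact: closedU.
  exact: withinU_continuous.
Qed.

Lemma lipschitz_within_continuous {R : realType} {V W : normedModType R}
    (A : set V) (f : V -> W) :
  [lipschitz f x | x in A] -> {within A, continuous f}.
Proof.
(* The Lipschitz bound holds for every constant above some [M]; [|M| + 1] is such a constant and is
   positive. *)
case=> M [_ fM]; have {fM} := fM (`|M| + 1).
rewrite (le_lt_trans (ler_norm M)) ?ltrDl // => /(_ isT) fM.
have M0 : 0 < `|M| + 1 :> R by rewrite ltr_wpDl.
apply/subspace_continuousP => x Ax; apply/cvgrPdist_lt => e e0.
rewrite near_withinE; near=> y => Ay.
rewrite (le_lt_trans (fM (x, y) _)) //= -ltr_pdivlMl //.
by near: y; apply: cvgr_dist_lt; [exact: cvg_id|rewrite mulr_gt0 ?invr_gt0].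
Unshelve. all: by end_near. Qed.

Lemma geometric_small {R : realType} (S C e : R) : 0 <= S < 1 -> 0 < e ->
  exists k, forall j, (k <= j)%N -> C * S ^+ j < e.
Proof.
move=> /andP[S0 S1] e0; have S1' : `|S| < 1 by rewrite ger0_norm.
have /cvgrPdist_lt /(_ e e0) [k _ kP] := cvg_geometric C S1'.
exists k => j /kP; rewrite /= sub0r normrN.
exact: le_lt_trans (ler_norm _).
Qed.

Lemma le0_of_le_geometric {R : realType} (S C x : R) :
  0 <= S < 1 -> (forall k, x <= C * S ^+ k) -> x <= 0.
Proof.
move=> S01 xle; rewrite leNgt; apply/negP => /(geometric_small _ C _ S01)[k].
by move=> /(_ k (leqnn k)); rewrite ltNge xle.
Qed.

Lemma closed_approx {R : realType} {V : normedModType R} (A : set V) (p : V) :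
  closed A -> (forall e, 0 < e -> exists2 a, A a & `|p - a| < e) -> A p.
Proof.
move=> Acl pA; apply: Acl => U /nbhs_ballP[e /= e0 eU].
have [a Aa pa] := pA e e0; exists a; split => //.
by apply: eU; rewrite -ball_normE.
Qed.

Lemma uniform_geometric_limit {R : realType} {T : topologicalType} (A : set T)
    (u : nat -> T -> R) (C S : R) :
  0 <= S < 1 -> (forall k, {within A, continuous u k}) ->
  (forall k x, A x -> `|u k.+1 x - u k x| <= C * S ^+ k) ->
  exists f : T -> R, {within A, continuous f} /\
    forall x, A x -> u k x @[k --> \oo] --> f x.
Proof.
move=> S01 uc uS; have /andP[S0 S1] := S01; pose M := C / (1 - S).
have tail k j x : A x -> `|u (k + j)%N x - u k x| <= M * S ^+ k.
  move=> Ax; have C0 : 0 <= C by have := le_trans (normr_ge0 _) (uS 0%N _ Ax);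
    rewrite expr0 mulr1.
  (* [M * S ^+ k] is the sum of the whole geometric tail; the factor [1 - S ^+ j] turns it into the
     exact partial sum, which the induction on [j] reproduces. *)
  have : `|u (k + j)%N x - u k x| <= M * S ^+ k * (1 - S ^+ j).
    elim: j => [|j IH]; first by rewrite addn0 !subrr normr0 mulr0.
    rewrite addnS -(subrKA (u (k + j)%N x)) (le_trans (ler_normD _ _)) //.
    apply: (le_trans (lerD (uS _ _ Ax) IH)); rewrite exprD exprS le_eqVlt.
    apply/orP; left; apply/eqP; rewrite /M; field; lra.
  move/le_trans; apply; rewrite ler_piMr // ?gerBl ?exprn_ge0 //.
  by rewrite mulr_ge0 ?exprn_ge0 // divr_ge0 // subr_ge0 ltW.
have ucvg x : A x -> cvg (u k x @[k --> \oo]).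
  move=> Ax; apply/cauchy_cvgP/cauchy_exP => e /(geometric_small _ M _ S01)[k Mk].
  exists (u k x); exists k => // j /= kj.
  by rewrite -ball_normE /= distrC -(subnKC kj) (le_lt_trans (tail _ _ _ Ax)) ?Mk.
exists (fun x => limn (u ^~ x)); split => //.
apply: (@uniform_limit_continuous_subspace _ _ A (u @ \oo)) => //.
  by near_simpl; apply: nearW.
move=> P /uniform_nbhs[B [/= eB BP]].
have [e e0 eBs] : exists2 e : R, 0 < e &
    forall a b : R, `|a - b| < e -> B (a, b).
  move: eB; rewrite -entourage_ballE => -[e /= e0 eBs].
  by exists e => // a b ab; apply: eBs; rewrite /= -ball_normE.
have [k Mk] := geometric_small _ M _ S01 e0.
exists k => // j /= kj; apply: BP => x Ax.
apply: eBs; apply: le_lt_trans (Mk j kj); have xcvg := ucvg x Ax.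
(* With [j] fixed, the tail bound passes to the limit in [i]; it does not depend on [x], so the
   convergence is uniform. *)
have dcvg : `|u i x - u j x| @[i --> \oo] --> `|limn (u ^~ x) - u j x|.
  by apply: cvg_norm; apply: cvgB => //; exact: cvg_cst.
rewrite -(cvg_lim (@Rhausdorff R) dcvg); apply: limr_le.
  by apply/cvg_ex; eexists; exact: dcvg.
by exists j => // i /= ji; rewrite -(subnKC ji); exact: tail.
Qed.

(** By monotonicity the largest of the constants works for all [i]. The maximum starts at 0, which
    makes it nonnegative and, as [b] is positive, keeps it below [b]. *)
Lemma finite_uniform_bound {R : realType} {I : finType} (P : I -> R -> Prop)
    (b : R) :
  0 < b -> (forall i c c', c <= c' -> P i c -> P i c') ->
  (forall i, exists2 c, c < b & P i c) ->
  exists2 c, 0 <= c < b & forall i, P i c.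
Proof.
move=> b0 Pmono Pex; have /all_sig2[c cb Pc] i := cid2 (Pex i).
exists (\big[Num.max/0]_i c i); last by move=> i; apply: Pmono (Pc i);
  exact: le_bigmax.
by rewrite bigmax_ge_id /=; apply: bigmax_lt.
Qed.

(** * Grid and regions *)

Section Grid.
Context {R : realType} {n : nat} (x : 'I_n.+1 -> R).

Lemma grid_cell (a b : 'I_n.+1) (u : R) : (a < b)%N -> x a <= u <= x b ->
  exists i : 'I_n, [/\ (a <= lo i)%N, (hi i <= b)%N & x (lo i) <= u <= x (hi i)].
Proof.
case: b => b; elim: b => [|k IH] //= kn; rewrite ltnS => ak /andP[au ub].
have kn' : (k < n)%N by [].
have hik : hi (Ordinal kn') = Ordinal kn by apply: val_inj.
(* Either [u] lies in the last cell before [b], or [b] moves one cell to the left; if [a] is already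
   the left end of that cell, [u] would be below [x a]. *)
have [ku|uk] := leP (x (lo (Ordinal kn'))) u.
  by exists (Ordinal kn'); rewrite hik; split => //; rewrite ku.
have [ak'|ka] := ltnP a k.
  have kn1 : (k < n.+1)%N by apply: ltnW.
  have lok : Ordinal kn1 = lo (Ordinal kn') by apply: val_inj.
  have [|i [ai ik iu]] := IH kn1 ak'; first by rewrite au lok ltW.
  by exists i; split => //; apply: leq_trans ik _ => /=.
have lok : a = lo (Ordinal kn') by apply: val_inj; apply/eqP; rewrite eqn_leq ak.
by move: uk; rewrite -lok ltNge au.
Qed.

Context (x_incr : forall i i' : 'I_n.+1, (i < i')%N -> x i < x i').

Lemma grid_le (a b : 'I_n.+1) : (a <= b)%N -> x a <= x b.
Proof.
rewrite leq_eqVlt => /orP[/eqP/val_inj -> //|/x_incr/ltW //].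
Qed.

Lemma grid_node_cell (i : 'I_n) (a : 'I_n.+1) :
  x (lo i) <= x a <= x (hi i) -> a = lo i \/ a = hi i.
Proof.
move=> /andP[ia ai].
have {}ia : (i <= a)%N by rewrite leqNgt; apply/negP => /(@x_incr a (lo i));
  rewrite ltNge ia.
have {}ai : (a <= i.+1)%N by rewrite leqNgt; apply/negP => /(@x_incr (hi i) a);
  rewrite ltNge ai.
move: ia; rewrite leq_eqVlt => /orP[/eqP ia|ia].
  by left; apply: val_inj; rewrite /= -ia.
by right; apply: val_inj; apply/eqP; rewrite /= eqn_leq ai.
Qed.

Lemma grid_cells_meet (i i' : 'I_n) (u : R) : i != i' ->
  x (lo i) <= u <= x (hi i) -> x (lo i') <= u <= x (hi i') -> exists a, u = x a.
Proof.
wlog : i i' / (i < i')%N.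
  move=> W ii' ui ui'; have [?|?] := ltnP i i'; first exact: (W i i').
  by apply: (W i' i) => //; rewrite 1?eq_sym // ltn_neqAle eq_sym ii'.
move=> ii' _ /andP[_ ui] /andP[iu _]; exists (hi i); apply/le_anti.
by rewrite ui (le_trans (grid_le _ _ _) iu).
Qed.

End Grid.

Section Geometry.
Context {R : realType} {n m l : nat} (D : rifs R n m l) (HD : rifs_axioms D).

Let xle := @grid_le _ _ _ (x_incr HD).
Let yle := @grid_le _ _ _ (y_incr HD).

(** The lines carrying the sides of the regions, where the pieces of the operator have to fit
    together. *)
Definition gridline (p : R * R) : Prop :=
  (exists a, p.1 = xg D a) \/ (exists b, p.2 = yg D b).

Lemma rectE_compact : compact (rectE D).
Proof. by apply: compact_setX; exact: segment_compact. Qed.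

Lemma region_compact i j : compact (region D i j).
Proof. by apply: compact_setX; exact: segment_compact. Qed.

Lemma region_closed i j : closed (region D i j).
Proof. by apply: compact_closed (region_compact i j); exact: norm_hausdorff. Qed.

Lemma region_sub i j : region D i j `<=` rectE D.
Proof.
move=> p [] /=; rewrite /Ix /Iy /= !in_itv /= => /andP[a b] /andP[c d].
split; rewrite /dom_x /dom_y /= in_itv /=.
  by rewrite (le_trans _ a) ?(le_trans b) // xle // -ltnS ltn_ord.
by rewrite (le_trans _ c) ?(le_trans d) // yle // -ltnS ltn_ord.
Qed.

Lemma tdomain_sub k : tdomain D k `<=` rectE D.
Proof.
move=> p [] /=; rewrite /dom_x /dom_y /= !in_itv /= => /andP[a b] /andP[c d].
split; rewrite /dom_x /dom_y /= in_itv /=.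
  by rewrite (le_trans _ a) ?(le_trans b) // xle // -ltnS ltn_ord.
by rewrite (le_trans _ c) ?(le_trans d) // yle // -ltnS ltn_ord.
Qed.

(** The sides of a domain lie on grid lines, so it is a union of regions. For a point in the domain
    of [r] this yields an index [s] with [Mmat D s r] positive. *)
Lemma tdomain_region k p : tdomain D k p ->
  exists i j, region D i j p /\ region D i j `<=` tdomain D k.
Proof.
case; rewrite /dom_x /dom_y /= !in_itv /= => px py.
have sxe : (sx D k < ex D k)%N.
  by apply: leq_trans (dom_x_size HD k); rewrite addn2.
have sye : (sy D k < ey D k)%N.
  by apply: leq_trans (dom_y_size HD k); rewrite addn2.
have [i [si ie ip]] := grid_cell (xg D) _ _ _ sxe px.
have [j [sj je jp]] := grid_cell (yg D) _ _ _ sye py.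
exists i, j; split; first by split; rewrite /Ix /Iy /= in_itv.
move=> q []; rewrite /Ix /Iy /= !in_itv /= => /andP[a b] /andP[c d].
split; rewrite /dom_x /dom_y /= in_itv /=.
  by rewrite (le_trans (xle _ _ si) a) (le_trans b (xle _ _ ie)).
by rewrite (le_trans (yle _ _ sj) c) (le_trans d (yle _ _ je)).
Qed.

Lemma rectE_region p : rectE D p -> exists i j, region D i j p.
Proof.
have /andP[l2 lnm] := l_bounds HD.
have nm0 : (0 < n * m)%N by apply: leq_trans lnm; apply: leq_trans l2.
have /andP[n0 m0] : (0 < n)%N && (0 < m)%N by rewrite -muln_gt0.
case; rewrite /= !in_itv /= => px py.
have [i [_ _ ip]] := grid_cell (xg D) ord0 ord_max _ n0 px.
have [j [_ _ jp]] := grid_cell (yg D) ord0 ord_max _ m0 py.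
by exists i, j; split; rewrite /Ix /Iy /= in_itv.
Qed.

Lemma rectE_bigcup :
  rectE D = \bigcup_(ij : 'I_n * 'I_m) region D ij.1 ij.2.
Proof.
apply/seteqP; split=> [p /rectE_region[i [j pij]]|p [ij _ /region_sub//]].
by exists (i, j).
Qed.

Lemma regions_meet i j i' j' p : (i, j) != (i', j') ->
  region D i j p -> region D i' j' p -> gridline p.
Proof.
rewrite xpair_eqE negb_and => ne [] /=; rewrite /Ix /Iy /= !in_itv /= => a b [].
rewrite /Ix /Iy /= !in_itv /= => c d.
have [ii'|jj'] := orP ne.
  by left; exact: (grid_cells_meet _ (x_incr HD) _ _ _ ii').
by right; exact: (grid_cells_meet _ (y_incr HD) _ _ _ jj').
Qed.

Lemma node_rectE a b : rectE D (xvec D a b).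
Proof.
by split; rewrite /= in_itv /= ?xle ?yle //= -ltnS ltn_ord.
Qed.

Lemma Lmap_region i j q : tdomain D (gam D i j) q -> region D i j (Lmap D i j q).
Proof.
case=> qx qy.
have [[[Lxf _ _] _ _] _] := Lx_contr HD i j.
have [[[Lyf _ _] _ _] _] := Ly_contr HD i j.
by split; [apply: Lxf|apply: Lyf].
Qed.

(** The inverses of the two coordinate maps combine; through [h] the operator can be written as a
    function on the region. *)
Lemma Lmap_inverse i j : exists h : R * R -> R * R,
  [/\ {within region D i j, continuous h},
      forall p, region D i j p -> tdomain D (gam D i j) (h p) /\ Lmap D i j (h p) = p &
      forall q, tdomain D (gam D i j) q -> h (Lmap D i j q) = q].
Proof.
have [[[_ _ Lxs] _ [hx hxc hxK]] _] := Lx_contr HD i j.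
have [[[_ _ Lys] _ [hy hyc hyK]] _] := Ly_contr HD i j.
exists (fun p => (hx p.1, hy p.2)); split.
- apply: within_continuous_pair.
    apply: (within_continuous_comp _ _ fst hx _ hxc).
      by apply: continuous_subspaceT => p; exact: cvg_fst.
    by move=> _ [p [? _] <-].
  apply: (within_continuous_comp _ _ snd hy _ hyc).
    by apply: continuous_subspaceT => p; exact: cvg_snd.
  by move=> _ [p [_ ?] <-].
- move=> [u v] [/= /Lxs[u' u'D <-] /Lys[v' v'D <-]].
  by rewrite /Lmap /= hxK // hyK.
- by move=> [u v] [/= uD vD]; rewrite /Lmap /= hxK // hyK.
Qed.

(** In a region, a point on a grid line has a coordinate at an end of its cell. The coordinate maps
    are injective and send ends onto ends, so it comes from the boundary of the domain, where the
    hypotheses on [g] apply. *)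
Lemma Lmap_gridline i j q : let k := gam D i j in
  tdomain D k q -> gridline (Lmap D i j q) ->
  (exists2 al, al \in [:: sx D k; ex D k] & q.1 = xg D al) \/
  (exists2 be, be \in [:: sy D k; ey D k] & q.2 = yg D be).
Proof.
move=> k qk; have [Lqx Lqy] := Lmap_region i j q qk; move: qk => [qx qy].
have [[[_ Lxi _] _ _] _] := Lx_contr HD i j.
have [[[_ Lyi _] _ _] _] := Ly_contr HD i j.
have sx_dom : dom_x D k (xg D (sx D k)) /\ dom_x D k (xg D (ex D k)).
  have se := xle _ _ (leq_trans (leq_addr 2 _) (dom_x_size HD k)).
  by split; rewrite /dom_x /dom_y /= in_itv /= lexx se.
have sy_dom : dom_y D k (yg D (sy D k)) /\ dom_y D k (yg D (ey D k)).
  have se := yle _ _ (leq_trans (leq_addr 2 _) (dom_y_size HD k)).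
  by split; rewrite /dom_x /dom_y /= in_itv /= lexx se.
case=> -[a /= aE]; [left|right].
- have : [set xg D (lo i); xg D (hi i)] (xg D a).
    move: Lqx; rewrite /Ix /= aE in_itv => /(grid_node_cell _ (x_incr HD)).
    by case=> ->; [left|right].
  rewrite -(Lx_ends HD i j) -aE /= => -[_ [] -> Lu].
  + exists (sx D k); rewrite ?inE ?eqxx //.
    by apply/esym/Lxi; rewrite ?inE //; exact: sx_dom.1.
  + exists (ex D k); rewrite ?inE ?eqxx ?orbT //.
    by apply/esym/Lxi; rewrite ?inE //; exact: sx_dom.2.
- have : [set yg D (lo j); yg D (hi j)] (yg D a).
    move: Lqy; rewrite /Iy /= aE in_itv => /(grid_node_cell _ (y_incr HD)).
    by case=> ->; [left|right].
  rewrite -(Ly_ends HD i j) -aE /= => -[_ [] -> Lu].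
  + exists (sy D k); rewrite ?inE ?eqxx //.
    by apply/esym/Lyi; rewrite ?inE //; exact: sy_dom.1.
  + exists (ey D k); rewrite ?inE ?eqxx ?orbT //.
    by apply/esym/Lyi; rewrite ?inE //; exact: sy_dom.2.
Qed.

End Geometry.

(** * The Read-Bajraktarevic operator *)

Section FixedPoint.
Context {R : realType} {n m l : nat} (D : rifs R n m l) (HD : rifs_axioms D).

(** The l1 norm, whereas the library norm [`|v|] of [R * R] is the maximum norm:
    [Sbar] is the norm of the scaling matrix for the former. *)
Definition norm1 (v : R * R) : R := `|v.1| + `|v.2|.

Lemma norm1_ge0 v : 0 <= norm1 v.
Proof. by rewrite addr_ge0. Qed.

Lemma norm1_le v : norm1 v <= 2 * `|v|.
Proof. by rewrite prod_normE mulr_natl mulr2n lerD // le_max lexx ?orbT. Qed.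

Lemma norm1_le0 v w : norm1 (v - w) <= 0 -> v = w.
Proof.
rewrite le_eqVlt ltNge norm1_ge0 orbF paddr_eq0 // !normr_eq0 !subr_eq0.
by case: v w => [a b] [c d] /= /andP[/eqP-> /eqP->].
Qed.

(** Compactness provides the constants that start the geometric estimates. *)
Lemma norm1_distr_bounded {T : topologicalType} (A : set T)
    (f h : T -> R * R) :
  compact A ->
  {within A, continuous f} -> {within A, continuous h} ->
  exists C, forall p, A p -> norm1 (f p - h p) <= C.
Proof.
move=> Ac fc hc.
have /compact_bounded[M [_ Mb]] : compact ((fun p => f p - h p) @` A).
  by apply: continuous_compact => // p; apply: cvgB; [exact: fc|exact: hc].
exists (2 * (`|M| + 1)) => p Ap; rewrite (le_trans (norm1_le _)) // ler_pM2l //.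
by apply: (Mb (`|M| + 1)); [rewrite (le_lt_trans (ler_norm M)) ?ltrDl|exists p].
Qed.

Lemma le_max_abs i j s p : scaling_factor D i j s -> region D i j p ->
  `|s p| <= max_abs D i j s.
Proof.
move=> [_ s1] ijp; apply: ub_le_sup; last by exists p.
by exists 1 => _ [q qij <-]; rewrite ltW // s1.
Qed.

Lemma Sbar_ge0 : 0 <= Sbar D.
Proof. exact: bigmax_ge_id. Qed.

Lemma scaling_le_Sbar i j p : region D i j p ->
  `|s1 D i j p| + `|s3 D i j p| <= Sbar D /\
  `|s2 D i j p| + `|s4 D i j p| <= Sbar D.
Proof.
move=> ijp.
have : Num.max (max_abs D i j (s1 D i j) + max_abs D i j (s3 D i j))
           (max_abs D i j (s2 D i j) + max_abs D i j (s4 D i j)) <= Sbar D.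
  rewrite /Sbar; apply: le_trans; last exact: (le_bigmax _ _ i).
  exact: (le_bigmax _ (fun j =>
    Num.max (max_abs D i j (s1 D i j) + max_abs D i j (s3 D i j))
            (max_abs D i j (s2 D i j) + max_abs D i j (s4 D i j))) j).
rewrite ge_max => /andP[S13 S24]; split.
  by apply: le_trans S13; rewrite lerD // le_max_abs //;
    [exact: s1_scal|exact: s3_scal].
by apply: le_trans S24; rewrite lerD // le_max_abs //;
  [exact: s2_scal|exact: s4_scal].
Qed.

(** The terms [q1], [q2] cancel, leaving the scaling matrix. Its l1 operator norm is the larger
    column sum, and [Sbar] bounds the columns ([s1], [s3]) and ([s2], [s4]). *)
Lemma Fmap_contr i j q v w : tdomain D (gam D i j) q ->
  norm1 (Fmap D i j q v - Fmap D i j q w) <= Sbar D * norm1 (v - w).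
Proof.
move=> /(Lmap_region D HD)/scaling_le_Sbar; rewrite /norm1 /Fmap /=.
move: (s1 _ _ _ _) (s2 _ _ _ _) (s3 _ _ _ _) (s4 _ _ _ _) => a b c d [ac bd].
have -> : forall e, a * v.1 + b * v.2 + e - (a * w.1 + b * w.2 + e) =
  a * (v.1 - w.1) + b * (v.2 - w.2) by move=> e; ring.
have -> : forall e, c * v.1 + d * v.2 + e - (c * w.1 + d * w.2 + e) =
  c * (v.1 - w.1) + d * (v.2 - w.2) by move=> e; ring.
move: (v.1 - w.1) (v.2 - w.2) => x y.
apply: le_trans (lerD (ler_normD _ _) (ler_normD _ _)) _.
rewrite !normrM mulrDr addrACA -!mulrDl.
by rewrite lerD // ler_wpM2r.
Qed.

Lemma Fmap_cvg i j q (v : nat -> R * R) w :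
  (v k).1 @[k --> \oo] --> w.1 -> (v k).2 @[k --> \oo] --> w.2 ->
  (Fmap D i j q (v k)).1 @[k --> \oo] --> (Fmap D i j q w).1 /\
  (Fmap D i j q (v k)).2 @[k --> \oo] --> (Fmap D i j q w).2.
Proof.
move=> v1 v2; split; (apply: cvgD; last exact: cvg_cst);
  by apply: cvgD; apply: cvgM => //; exact: cvg_cst.
Qed.

Context (g : R * R -> R * R) (g_cont : {within rectE D, continuous g})
  (g_x : forall (i : 'I_n) (j : 'I_m), let k := gam D i j in
    forall (al : 'I_n.+1) (v : R), al \in [:: sx D k; ex D k] -> dom_y D k v ->
      Fmap D i j (xg D al, v) (g (xg D al, v)) = g (Lmap D i j (xg D al, v)))
  (g_y : forall (i : 'I_n) (j : 'I_m), let k := gam D i j in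
    forall (be : 'I_m.+1) (u : R), be \in [:: sy D k; ey D k] -> dom_x D k u ->
      Fmap D i j (u, yg D be) (g (u, yg D be)) = g (Lmap D i j (u, yg D be))).

(** The class of functions on which the operator acts and which it preserves. *)
Definition extends_gridlines (h : R * R -> R * R) : Prop :=
  {within rectE D, continuous h} /\
  forall p, rectE D p -> gridline D p -> h p = g p.

(** [h'] is the image of [h] under the Read-Bajraktarevic operator. *)
Definition RB_image (h h' : R * R -> R * R) : Prop :=
  forall i j q, tdomain D (gam D i j) q ->
    h' (Lmap D i j q) = Fmap D i j q (h q).

(** Here [q] is on the boundary of the domain, hence itself on a grid line, so that [h q = g q] and
    the hypotheses on [g] give the value. *)
Lemma Fmap_gridline h i j q : extends_gridlines h -> tdomain D (gam D i j) q ->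
  gridline D (Lmap D i j q) -> Fmap D i j q (h q) = g (Lmap D i j q).
Proof.
move=> [_ hg] qk qg; have qE := tdomain_sub D HD _ _ qk.
have [qx qy] := qk.
have [[al alk qE']|[be bek qE']] := Lmap_gridline D HD i j q qk qg.
- rewrite hg //; last by left; exists al.
  by move: qy; rewrite [q]surjective_pairing qE' /= => /g_x ->.
- rewrite hg //; last by right; exists be.
  by move: qx; rewrite [q]surjective_pairing qE' /= => /g_y ->.
Qed.

Lemma RB_step h : extends_gridlines h ->
  exists h', extends_gridlines h' /\ RB_image h h'.
Proof.
move=> hgood.
have /choice[inv invP] (ij : 'I_n * 'I_m) := Lmap_inverse D HD ij.1 ij.2.
pose F (ij : 'I_n * 'I_m) p := Fmap D ij.1 ij.2 (inv ij p) (h (inv ij p)).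
(* At a point of several regions any choice serves, as the candidate values all equal that of [g];
   outside all regions [g p] is only a default. *)
pose h' p := if [pick ij | `[< region D ij.1 ij.2 p >]] is Some ij then F ij p
             else g p.
have Fg ij p : region D ij.1 ij.2 p -> gridline D p -> F ij p = g p.
  have [_ invD _] := invP ij.
  move=> /invD[pk pE] pg; rewrite /F Fmap_gridline ?pE //.
have h'E ij p : region D ij.1 ij.2 p -> h' p = F ij p.
  move=> ijp; rewrite /h'; case: pickP => [ij' /asboolP ijp'|/(_ ij)/asboolP//].
  have [->//|ne] := eqVneq ij' ij.
  have pg : gridline D p.
    apply: (regions_meet D HD _ _ _ _ _ _ ijp' ijp).
    by rewrite -!surjective_pairing.
  by rewrite !Fg.
exists h'; split; [split|].
- rewrite (rectE_bigcup D HD); apply: within_continuous_bigcup => [ij|ij].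
    exact: region_closed.
  have [invc invD _] := invP ij.
  have invE : inv ij @` region D ij.1 ij.2 `<=` tdomain D (gam D ij.1 ij.2).
    by move=> _ [p /invD[? _] <-].
  have [hc _] := hgood.
  have hic : {within region D ij.1 ij.2, continuous (h \o inv ij)}.
    apply: (within_continuous_comp _ _ _ _ invc hc).
    by apply: subset_trans invE (tdomain_sub D HD _).
  (* On the region [Lmap] undoes [inv ij], so the scaling factors can be evaluated at [p] itself. *)
  pose G p := (s1 D ij.1 ij.2 p * (h (inv ij p)).1 +
    s2 D ij.1 ij.2 p * (h (inv ij p)).2 + q1 D ij.1 ij.2 (inv ij p),
    s3 D ij.1 ij.2 p * (h (inv ij p)).1 +
    s4 D ij.1 ij.2 p * (h (inv ij p)).2 + q2 D ij.1 ij.2 (inv ij p)).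
  apply: (@subspace_eq_continuous _ _ _ G).
    move=> p /[!inE] ijp; rewrite -[RHS]/(h' p) (h'E ij) // /F /Fmap.
    by have [_ ->] := invD _ ijp.
  have lipc s : scaling_factor D ij.1 ij.2 s ->
      {within region D ij.1 ij.2, continuous s}.
    by move=> [/lipschitz_within_continuous].
  have h1c : {within region D ij.1 ij.2, continuous (fun p => (h (inv ij p)).1)}.
    by move=> p; apply: (cvg_comp (h \o inv ij) fst); [exact: hic|exact: cvg_fst].
  have h2c : {within region D ij.1 ij.2, continuous (fun p => (h (inv ij p)).2)}.
    by move=> p; apply: (cvg_comp (h \o inv ij) snd); [exact: hic|exact: cvg_snd].
  have q1c : {within region D ij.1 ij.2, continuous (q1 D ij.1 ij.2 \o inv ij)}.
    apply: (within_continuous_comp _ _ _ _ invc _ invE).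
    exact/lipschitz_within_continuous/q1_lip.
  have q2c : {within region D ij.1 ij.2, continuous (q2 D ij.1 ij.2 \o inv ij)}.
    apply: (within_continuous_comp _ _ _ _ invc _ invE).
    exact/lipschitz_within_continuous/q2_lip.
  have s1c := lipc _ (s1_scal HD _ _); have s2c := lipc _ (s2_scal HD _ _).
  have s3c := lipc _ (s3_scal HD _ _); have s4c := lipc _ (s4_scal HD _ _).
  apply: within_continuous_pair => p.
    apply: cvgD; last exact: q1c.
    apply: cvgD; apply: cvgM; [exact: s1c|exact: h1c|exact: s2c|exact: h2c].
  apply: cvgD; last exact: q2c.
  apply: cvgD; apply: cvgM; [exact: s3c|exact: h1c|exact: s4c|exact: h2c].
- move=> p /(rectE_region D HD)[i [j ijp]] pg.
  by rewrite (h'E (i, j)) // Fg.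
- move=> i j q qk; rewrite (h'E (i, j)); last exact: Lmap_region.
  by have [_ _ invK] := invP (i, j); rewrite /F /= invK.
Qed.

Lemma RB_fixed_point : Sbar D < 1 ->
  exists f, extends_gridlines f /\ RB_image f f.
Proof.
move=> S1; have S01 : 0 <= Sbar D < 1 by rewrite Sbar_ge0.
(* Bundling each function with its membership in the class turns the operator into a self-map, which
   can be iterated from [g]. *)
have /choice[T TP] (h : {h | extends_gridlines h}) :
    exists h' : {h | extends_gridlines h}, RB_image (sval h) (sval h').
  have [h' [h'g hh']] := RB_step _ (svalP h).
  by exists (exist _ h' h'g).
have g0 : extends_gridlines g by [].
pose f_ k : R * R -> R * R := sval (iter k T (exist _ g g0)).
have f_g k : extends_gridlines (f_ k) by exact: svalP.
have f_S k : RB_image (f_ k) (f_ k.+1) by exact: TP.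
have [C Cb] := norm1_distr_bounded _ _ _ (rectE_compact D) (f_g 1%N).1 (f_g 0%N).1.
(* Every point of the rectangle is the image of a point of some domain, so each step shrinks the
   distance of successive iterates by [Sbar]. *)
have fC k p : rectE D p -> norm1 (f_ k.+1 p - f_ k p) <= C * Sbar D ^+ k.
  elim: k p => [|k IH] p pE; first by rewrite expr0 mulr1 Cb.
  have [i [j ijp]] := rectE_region D HD _ pE.
  have [inv [_ invD _]] := Lmap_inverse D HD i j.
  have [qk <-] := invD _ ijp; rewrite !f_S //.
  apply: le_trans (Fmap_contr _ _ _ _ _ qk) _.
  rewrite exprS mulrCA ler_wpM2l ?Sbar_ge0 // IH //.
  exact: tdomain_sub qk.
have [a [ac alim]] : exists a : R * R -> R, {within rectE D, continuous a} /\
    forall p, rectE D p -> (f_ k p).1 @[k --> \oo] --> a p.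
  apply: (uniform_geometric_limit _ (fun k p => (f_ k p).1) C _ S01).
    move=> k p; apply: (cvg_comp (f_ k) fst); [exact: (f_g k).1|exact: cvg_fst].
  by move=> k p pE; apply: le_trans (fC k p pE); rewrite lerDl.
have [b [bc blim]] : exists b : R * R -> R, {within rectE D, continuous b} /\
    forall p, rectE D p -> (f_ k p).2 @[k --> \oo] --> b p.
  apply: (uniform_geometric_limit _ (fun k p => (f_ k p).2) C _ S01).
    move=> k p; apply: (cvg_comp (f_ k) snd); [exact: (f_g k).1|exact: cvg_snd].
  by move=> k p pE; apply: le_trans (fC k p pE); rewrite lerDr.
exists (fun p => (a p, b p)); split; [split|].
- exact: within_continuous_pair.
- move=> p pE pg; rewrite [g p]surjective_pairing; congr pair.
    apply: (cvg_unique _ (alim p pE)) => //=.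
    by under eq_cvg do rewrite (f_g _).2 //; exact: cvg_cst.
  apply: (cvg_unique _ (blim p pE)) => //=.
  by under eq_cvg do rewrite (f_g _).2 //; exact: cvg_cst.
(* Both sides of the relation between [f_ k.+1] and [f_ k] converge; their limits give the fixed
   point equation. *)
- move=> i j q qk; have qE := tdomain_sub D HD _ _ qk.
  have LqE : rectE D (Lmap D i j q) by exact/(region_sub D HD)/(Lmap_region D HD).
  have [F1 F2] := Fmap_cvg i j q (f_^~ q) (a q, b q) (alim q qE) (blim q qE).
  rewrite [RHS]surjective_pairing; congr pair.
    apply: (cvg_unique _ _ F1) => //; rewrite /mkset; under eq_cvg do rewrite -f_S //.
    by have := alim _ LqE; rewrite -cvg_shiftS.
  apply: (cvg_unique _ _ F2) => //; rewrite /mkset; under eq_cvg do rewrite -f_S //.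
  by have := blim _ LqE; rewrite -cvg_shiftS.
Qed.

End FixedPoint.

(** * The attractor *)

Section Attractor.
Context {R : realType} {n m l : nat} (D : rifs R n m l) (HD : rifs_axioms D).

(** When the inclusion holds, the domain of [r] is among those counted by [num_domains], so the
    inverse is that of a positive number. *)
Lemma Mmat_gt0 s r : 0 < Mmat D s r <-> region_of D s `<=` domain_of D r.
Proof.
rewrite mxE; case: asboolP => sr; last by rewrite ltxx.
split=> // _; rewrite invr_gt0 ltr0n card_gt0; apply/set0Pn.
by exists (gam D (tau_inv r).1 (tau_inv r).2); rewrite inE; apply/asboolP.
Qed.

Lemma Lmap_contraction : exists2 c : R, 0 <= c < 1 & forall i j q q',
  tdomain D (gam D i j) q -> tdomain D (gam D i j) q' ->
  `|Lmap D i j q - Lmap D i j q'| <= c * `|q - q'|.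
Proof.
pose P (ij : 'I_n * 'I_m) (c : R) := forall q q',
  tdomain D (gam D ij.1 ij.2) q -> tdomain D (gam D ij.1 ij.2) q' ->
  `|Lmap D ij.1 ij.2 q - Lmap D ij.1 ij.2 q'| <= c * `|q - q'|.
have [|||c c01 Pc] := @finite_uniform_bound R _ P 1.
- by [].
- move=> ij c c' cc' Pc q q' qk qk'; apply: le_trans (Pc _ _ qk qk') _.
  exact: ler_wpM2r.
- move=> [i j]; have [_ [cx cx1 cxP]] := Lx_contr HD i j.
  have [_ [cy cy1 cyP]] := Ly_contr HD i j.
  (* For the maximum norm on pairs the larger coordinate constant serves; 0 is included to make it
     nonnegative. *)
  exists (Num.max 0 (Num.max cx cy)); first by rewrite !gt_max ltr01 cx1.
  set c := Num.max 0 _; have c0 : 0 <= c by rewrite le_max lexx.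
  have cxc : cx <= c by rewrite !le_max lexx !orbT.
  have cyc : cy <= c by rewrite !le_max lexx !orbT.
  move=> [u v] [u' v'] [/= ux vy] [/= ux' vy'].
  rewrite !prod_normE /= ge_max; apply/andP; split.
    apply: le_trans (cxP (u, u') (conj ux ux')) _ => /=.
    apply: le_trans (ler_wpM2r (normr_ge0 _) cxc) (ler_wpM2l c0 _).
    by rewrite le_max lexx.
  apply: le_trans (cyP (v, v') (conj vy vy')) _ => /=.
  apply: le_trans (ler_wpM2r (normr_ge0 _) cyc) (ler_wpM2l c0 _).
  by rewrite le_max lexx orbT.
- by exists c => // i j; exact: (Pc (i, j)).
Qed.

Context (f : R * R -> R * R) (f_cont : {within rectE D, continuous f})
  (f_fix : RB_image D f f).

(** By the fixed point equation [W_of D r] sends the graph point over [q] to the one over its image.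
    Each point of region [r] is such an image, with [q] in a region contained in the domain of
    [r]. *)
Lemma graph_invariant :
  invariant_family D (fun r => graph_on (region_of D r) f).
Proof.
move=> r; split.
- exists (xvec D (lo (tau_inv r).1) (lo (tau_inv r).2),
          f (xvec D (lo (tau_inv r).1) (lo (tau_inv r).2))).
  exists (xvec D (lo (tau_inv r).1) (lo (tau_inv r).2)) => //.
  split; rewrite /Ix /Iy /= in_itv /= lexx ?(grid_le _ (x_incr HD)) //.
  exact: (grid_le _ (y_incr HD)).
- apply: (@continuous_compact _ _ (fun p => (p, f p))).
    apply: within_continuous_pair; first by apply: continuous_subspaceT => p.
    by apply: continuous_subspaceW f_cont; exact: region_sub.
  exact: region_compact.
- by move=> _ [p pr <-].
- apply/seteqP; split.
    move=> _ [p pr <-].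
    have [inv [_ invD _]] := Lmap_inverse D HD (tau_inv r).1 (tau_inv r).2.
    have [qk qE] := invD _ pr; have [i [j [ijq ijk]]] := tdomain_region D HD _ _ qk.
    exists (tau (i, j)); first by apply/Mmat_gt0; rewrite /region_of tauK.
    exists (inv p, f (inv p)).
      by exists (inv p) => //; rewrite /region_of tauK.
    by rewrite /W_of /Wmap /= -f_fix // qE.
  move=> _ [s /Mmat_gt0 sr [_ [q qs <-] <-]]; have qk := sr _ qs.
  exists (Lmap D (tau_inv r).1 (tau_inv r).2 q); first exact: (Lmap_region D HD).
  by rewrite /W_of /Wmap /= -f_fix.
Qed.

(** * Uniqueness of the invariant family *)

Section Unique.
Context (B : 'I_(n * m) -> set ((R * R) * (R * R))) (HB : invariant_family D B).

Lemma invariant_preimage r w : B r w -> exists s w',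
  [/\ B s w', domain_of D r w'.1 & w = W_of D r w'].
Proof.
have [_ _ _ {1}->] := HB r; case=> s /Mmat_gt0 sr [w' sw' <-].
exists s, w'; split => //; apply: sr.
by have [_ _ BsE _] := HB s; case: (BsE w' sw').
Qed.

Lemma invariant_image r s w : region_of D s `<=` domain_of D r -> B s w ->
  B r (W_of D r w).
Proof.
move=> /Mmat_gt0 sr sw; have [_ _ _ ->] := HB r.
by exists s => //; exists w.
Qed.

Lemma invariant_region r w : B r w -> region_of D r w.1.
Proof. by have [_ _ BrE _] := HB r; case/BrE. Qed.

Lemma invariant_on_graph r w : Sbar D < 1 -> B r w -> w.2 = f w.1.
Proof.
move=> S1 rw; have S01 : 0 <= Sbar D < 1 by rewrite Sbar_ge0.
have /choice[K KP] s : exists K, forall w, B s w -> norm1 (w.2 - f w.1) <= K.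
  have [_ Bs _ _] := HB s.
  apply: (norm1_distr_bounded _ snd (f \o fst) Bs).
    by apply: continuous_subspaceT => p; exact: cvg_snd.
  apply: (within_continuous_comp _ _ _ _ _ f_cont).
    by apply: continuous_subspaceT => p; exact: cvg_fst.
  by move=> _ [p /invariant_region/(region_sub D HD) ? <-].
apply: norm1_le0; apply: (le0_of_le_geometric _ (\big[Num.max/0]_s K s) _ S01) => k.
(* A point of [B r] is the image of a point of some [B s], and the map contracts the vertical
   distance to the graph by [Sbar]; hence the induction runs over all [r] and [w]. *)
elim: k r w rw => [|k IH] r w rw.
  by rewrite expr0 mulr1; apply: le_trans (KP _ _ rw) (le_bigmax _ _ _).
have [s [w' [sw' w'k ->]]] := invariant_preimage _ _ rw.
rewrite /W_of /Wmap /= f_fix //; apply: le_trans (Fmap_contr D HD _ _ _ _ _ w'k) _.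
by rewrite exprS mulrCA ler_wpM2l ?Sbar_ge0 // (IH s).
Qed.

Lemma invariant_projection r : region_of D r `<=` fst @` B r.
Proof.
have [c c01 Lc] := Lmap_contraction; have /andP[c0 _] := c01.
have [M [_ Mb]] := compact_bounded (rectE_compact D).
(* A bound for the diameter of the rectangle: twice a bound for the norm of its points. *)
pose K := `|M| + 1 + (`|M| + 1).
have Kb p q : rectE D p -> rectE D q -> `|p - q| <= K.
  move=> pE qE; apply: le_trans (ler_normB _ _) _.
  by apply: lerD; apply: Mb => //; rewrite (le_lt_trans (ler_norm M)) ?ltrDl.
(* Pull [p] back to the domain of [s], approximate it there within a region contained in that
   domain, and push forward by the contraction. *)
have approx k s p : region_of D s p -> exists2 w, B s w & `|p - w.1| <= K * c ^+ k.
  elim: k s p => [|k IH] s p sp.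
    have [[w sw] _ _ _] := HB s; exists w => //; rewrite expr0 mulr1.
    by apply: Kb; [exact: (region_sub D HD) sp|
      exact: (region_sub D HD) (invariant_region _ _ sw)].
  have [inv [_ invD _]] := Lmap_inverse D HD (tau_inv s).1 (tau_inv s).2.
  have [qk qE] := invD _ sp; have [i [j [ijq ijk]]] := tdomain_region D HD _ _ qk.
  have ts : region_of D (tau (i, j)) `<=` domain_of D s by rewrite /region_of tauK.
  have [|w tw wq] := IH (tau (i, j)) (inv p); first by rewrite /region_of tauK.
  exists (W_of D s w); first exact: invariant_image ts tw.
  rewrite -{1}qE; apply: le_trans (Lc _ _ _ _ qk _) _.
    exact/ts/invariant_region.
  by rewrite exprS mulrCA ler_wpM2l.
move=> p rp; have [_ Brc _ _] := HB r; apply: closed_approx.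
  apply: compact_closed; first exact: norm_hausdorff.
  apply: continuous_compact => //.
  by apply: continuous_subspaceT => q; exact: cvg_fst.
move=> e /(geometric_small _ K _ c01)[k /(_ k (leqnn k)) Ke].
have [w rw pw] := approx k r p rp.
by exists w.1; [exists w|exact: le_lt_trans Ke].
Qed.

Lemma invariant_eq_graph r : Sbar D < 1 -> B r = graph_on (region_of D r) f.
Proof.
move=> S1; apply/seteqP; split=> [w rw|_ [p rp <-]].
  exists w.1; first exact: invariant_region.
  by rewrite -(invariant_on_graph _ _ S1 rw) -surjective_pairing.
have [w rw <-] := invariant_projection r p rp.
by rewrite -(invariant_on_graph _ _ S1 rw) -surjective_pairing.
Qed.

End Unique.

Lemma attractor_graph : Sbar D < 1 -> attractor D = graph_on (rectE D) f.
Proof.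
move=> S1; pose G r := graph_on (region_of D r) f.
have -> : attractor D = \bigcup_r G r.
  (* [G] is invariant and equals every invariant family; conversely, a family that is the unique
     invariant one must equal [G]. *)
  rewrite /attractor (_ : xget _ _ = G) //; apply: xget_unique.
    split; first exact: graph_invariant.
    by move=> B HB; apply/funext => r; rewrite (invariant_eq_graph _ HB).
  by move=> B [_ /(_ _ graph_invariant)].
apply/seteqP; split=> [w [r _ [p rp <-]]|_ [p /(rectE_region D HD)[i [j ijp]] <-]].
  by exists p => //; exact: (region_sub D HD) rp.
by exists (tau (i, j)) => //; exists p => //; rewrite /region_of tauK.
Qed.

End Attractor.

Theorem theorem4 (R : realType) (n m l : nat) (D : rifs R n m l)
    (HD : rifs_axioms D) (HS : Sbar D < 1)
    (g : R * R -> R * R)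
    (g_cont : {within rectE D, continuous g})
    (g_interp : forall (i : 'I_n.+1) (j : 'I_m.+1), g (xvec D i j) = zvec D i j)
    (g_x : forall (i : 'I_n) (j : 'I_m), let k := gam D i j in
      forall (al : 'I_n.+1) (v : R), al \in [:: sx D k; ex D k] -> dom_y D k v ->
        Fmap D i j (xg D al, v) (g (xg D al, v)) = g (Lmap D i j (xg D al, v)))
    (g_y : forall (i : 'I_n) (j : 'I_m), let k := gam D i j in
      forall (be : 'I_m.+1) (u : R), be \in [:: sy D k; ey D k] -> dom_x D k u ->
        Fmap D i j (u, yg D be) (g (u, yg D be)) = g (Lmap D i j (u, yg D be))) :
  exists f : R * R -> R * R,
    [/\ {within rectE D, continuous f},
        forall (i : 'I_n.+1) (j : 'I_m.+1), f (xvec D i j) = zvec D i j &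
        graph_on (rectE D) f = attractor D].
Proof.
have [f [[f_cont f_g] f_fix]] := RB_fixed_point D HD g g_cont g_x g_y HS.
exists f; split => //; last by rewrite (attractor_graph D HD f).
(* Grid points lie on grid lines, where [f] equals [g]. *)
move=> i j; rewrite f_g ?g_interp //; first exact: node_rectE.
by left; exists i.
Qed.
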